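(* Every subgroup of even order of a finite abelian group $G$ is a total perfect code of some Cayley sum graph of $G$.
   Context: For a normal subset $X$ of a finite group $G$ (i.e. $g^{-1}Xg=X$ for all $g\in G$), the Cayley sum graph $\mathrm{CS}(G,X)$ is the simple graph with vertex set $G$ in which distinct vertices $g,h$ are adjacent iff $gh\in X$. A total perfect code in a graph is a set $C$ of vertices such that every vertex of the graph has exactly one neighbour in $C$. *)

(* Defs.v *)
From mathcomp Require Import all_boot all_fingroup.

Set Implicit Arguments.
Unset Strict Implicit.
Unset Printing Implicit Defensive.

Local Open Scope group_scope.

Definition normal_subset (gT : finGroupType) (G X : {set gT}) : Prop :=
  X \subset G /\ {in G, forall g, X :^ g = X}.

(* A graph is given by a vertex set V : {set T} and an adjacency relation on T;
   C is a total perfect code when each vertex has exactly one neighbour in C. *)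
Definition total_perfect_code (T : finType) (V : {set T}) (adj : rel T)
    (C : {set T}) : Prop :=
  C \subset V /\ {in V, forall v, #|[set c in C | adj v c]| = 1%N}.

(* Adjacency of CS(G, X), whose vertex set is G. *)
Definition cayley_sum_adj (gT : finGroupType) (G X : {set gT}) : rel gT :=
  fun g h => [&& g \in G, h \in G, g != h & g * h \in X].

Lemma cayley_sum_adj_irr (gT : finGroupType) (G X : {set gT}) :
  irreflexive (cayley_sum_adj G X).
Proof. by move=> g; rewrite /cayley_sum_adj eqxx !andbF. Qed.

Lemma cayley_sum_adj_sym (gT : finGroupType) (G X : {set gT}) :
  normal_subset G X -> symmetric (cayley_sum_adj G X).
Proof.
move=> [_ nXG] g h; rewrite /cayley_sum_adj eq_sym.
case Gg: (g \in G) => /=; last by rewrite andbF.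
case Gh: (h \in G) => //=.
have -> : h * g = (g * h) ^ g by rewrite conjgE !mulgA mulVg mul1g.
by rewrite -{2}(nXG g Gg) memJ_conjg.
Qed.

(* Main.v *)
Require Import Defs.
From mathcomp Require Import all_boot all_fingroup.
From mathcomp Require Import pgroup.

(** Since [H] has an involution, squaring is not injective on [H], hence not
    surjective: some [x0] in [H] is not a square of an element of [H]. Take for
    [X] a transversal of [H] in [G] meeting [H] in [x0]. Each vertex [v] then has
    exactly one [h] in [H] with [v * h] in [X], and [v <> h] because otherwise
    [v] would lie in [H] and [x0] would be the square of [v]. *)

Set Implicit Arguments.
Unset Strict Implicit.
Unset Printing Implicit Defensive.

Local Open Scope group_scope.

Lemma exists_nonsquare (gT : finGroupType) (H : {group gT}) :
  2 %| #|H| -> exists2 x, x \in H & {in H, forall v, v * v != x}.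
Proof.
move=> evenH; have [t Ht ord_t] := Cauchy (isT : prime 2) evenH.
pose sq (v : gT) := v * v.
have sqH : sq @: H \subset H by apply/subsetP=> _ /imsetP[v Hv ->]; apply: groupM.
have [/subsetP H_sq | /subsetPn[x Hx sq'x]] := boolP (H \subset sq @: H).
  have /imset_injP sq_inj : #|sq @: H| == #|H|.
    by rewrite eqn_leq leq_imset_card subset_leq_card //; apply/subsetP.
  (* The involution [t] and [1] have the same square. *)
  have t1 : t = 1.
    by apply: sq_inj; rewrite ?group1 // /sq mulg1 -expg2 -ord_t expg_order.
  by rewrite t1 order1 in ord_t.
exists x => // v Hv; apply: contraNneq sq'x => <-.
exact: (imset_f sq).
Qed.

Lemma abelian_normal_subset (gT : finGroupType) (G : {group gT}) (X : {set gT}) :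
  abelian G -> X \subset G -> normal_subset G X.
Proof.
move=> abG sXG; split=> // g Gg; apply/normP.
by apply: subsetP Gg; apply/cents_norm/(subset_trans abG)/centS.
Qed.

(** The transversal is encoded as a choice function whose image on [G] will be [X]. Constancy on
    left cosets gives uniqueness of the neighbour; the value [x0] on [H] rules out loops. *)
Lemma exists_transversal_through (gT : finGroupType) (G H : {group gT}) (x0 : gT) :
  H \subset G -> x0 \in H ->
  exists2 f : gT -> gT, {in H, forall v, f v = x0} &
    {in G, forall v, f v \in v *: H} /\
    forall v w, v *: H = w *: H -> f v = f w.
Proof.
move=> sHG Hx0.
exists (fun v => if v *: H == H then x0 else repr (v *: H)) => [v Hv|].
  by rewrite lcoset_id ?eqxx.
split=> [v _|v w -> //].
by case: eqP => [-> // | _]; apply: mem_repr (lcoset_refl H v).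
Qed.

Theorem theorem5p4 (gT : finGroupType) (G H : {group gT}) :
  abelian G -> H \subset G -> (2 %| #|H|)%N ->
  exists X : {set gT},
    normal_subset G X /\ total_perfect_code G (cayley_sum_adj G X) H.
Proof.
move=> abG sHG /exists_nonsquare[x0 Hx0 nsq_x0].
have [f fH [f_lcoset f_eq]] := exists_transversal_through sHG Hx0.
have sXG : f @: G \subset G.
  apply/subsetP=> _ /imsetP[v Gv ->].
  by have /lcosetP[h Hh ->] := f_lcoset v Gv; rewrite groupM // (subsetP sHG).
exists (f @: G); split; first exact: abelian_normal_subset.
(* The witness solves [v * h = f v], where [f v] represents the coset of [v]. *)
split=> // v Gv; apply/eqP/cards1P; exists (v^-1 * f v).
apply/setP=> h; rewrite !inE /cayley_sum_adj Gv /=.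
apply/andP/eqP=> [[Hh /and3P[_ _ /imsetP[w Gw vh_fw]]] | def_h].
  (* As [h] is in [H], [v * h = f w] lies in both [v *: H] and [w *: H], so these cosets
     coincide. *)
  suffices -> : f v = v * h by rewrite mulKg.
  rewrite vh_fw; apply: f_eq.
  have := f_lcoset w Gw; rewrite -vh_fw => /lcoset_eqP <-.
  by rewrite lcosetM lcoset_id.
have Hh : h \in H by rewrite def_h -mem_lcoset f_lcoset.
rewrite (subsetP sHG) // def_h mulKVg imset_f // -def_h; split=> //.
rewrite /= andbT; apply/eqP=> v_h; have Hv : v \in H by rewrite v_h.
by move: (nsq_x0 v Hv); rewrite {2}v_h def_h mulKVg fH ?eqxx.
Qed.
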